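(* Let $(\mathcal{G},X)$ be a relative ultragraph and set $Y:=\mathrm{Reg}(\mathcal{G})\setminus X$. Suppose that $r(e)\cap Y$ is finite for all $e\in\mathcal{G}^1$. Then there is a $*$-isomorphism $\phi:C^*(\mathcal{G},X)\to C^*(\mathcal{G}_X)$ such that, for all $B\in\mathcal{E}$ and $e\in\mathcal{G}^1$, $$\phi(p_B)=P_B+P_{(B\cap Y)'},\qquad \phi(s_e)=\begin{cases}S_e,& r(e)\cap Y=\emptyset,\\ S_e+S_{e'},& r(e)\cap Y\neq\emptyset,\end{cases}$$ and its inverse is the $*$-homomorphism $\psi:C^*(\mathcal{G}_X)\to C^*(\mathcal{G},X)$ determined as follows. With $q_w:=p_w-\sum_{g\in\mathcal{G}^1,\,s(g)=w}s_gs_g^*$ for $w\in \mathrm{Reg}(\mathcal{G})$: for $Z\in\mathcal{E}_X$ written as $Z=A\cup(B\cap Y)'$ with $A,B\in\mathcal{E}$, $$\psi(P_Z)=p_A-p_{A\cap Y}+\sum_{g\in\mathcal{G}^1,\ s(g)\in A\cap Y}s_gs_g^*+\sum_{w\in B\cap Y}q_w ;$$ for $e\in\mathcal{G}^1$, $$\psi(S_e)=s_e\Bigl(p_{r(e)}-p_{r(e)\cap Y}+\sum_{g\in\mathcal{G}^1,\ s(g)\in r(e)\cap Y}s_gs_g^*\Bigr);$$ and for $e\in\mathcal{G}^1$ with $r(e)\cap Y\ne\emptyset$, $$\psi(S_{e'})=s_e\Bigl(p_{r(e)\cap Y}-\sum_{g\in\mathcal{G}^1,\ s(g)\in r(e)\cap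 Y}s_gs_g^*\Bigr).$$
   Context: An ultragraph $\mathcal{G}=(\mathcal{G}^0,\mathcal{G}^1,r,s)$ consists of countable sets $\mathcal{G}^0$ (vertices) and $\mathcal{G}^1$ (edges), a map $s:\mathcal{G}^1\to\mathcal{G}^0$ and a map $r:\mathcal{G}^1\to P(\mathcal{G}^0)$ (power set). $\mathcal{E}$ denotes the smallest family of subsets of $\mathcal{G}^0$ containing $\emptyset$, all $\{v\}$ ($v\in\mathcal{G}^0$) and all $r(e)$ ($e\in\mathcal{G}^1$), and closed under finite unions and finite intersections. $\mathrm{Reg}(\mathcal{G})=\{v\in\mathcal{G}^0:0<|s^{-1}(v)|<\infty\}$. A relative ultragraph is a pair $(\mathcal{G},X)$ with $\mathcal{G}$ an ultragraph and $X\subseteq\mathrm{Reg}(\mathcal{G})$. $C^*(\mathcal{G},X)$ is the universal $C^*$-algebra generated by partial isometries $\{s_e:e\in\mathcal{G}^1\}$ with mutually orthogonal ranges and projections $\{p_A:A\in\mathcal{E}\}$ (with $p_v:=p_{\{v\}}$) satisfying: (1) $p_\emptyset=0$, $p_Ap_B=p_{A\cap B}$, $p_{A\cup B}=p_A+p_B-p_{A\cap B}$ for $A,B\in\mathcal{E}$; (2) $s_e^*s_e=p_{r(e)}$; (3) $s_es_e^*\le p_{s(e)}$; (4) $p_v=\sum_{s(e)=v}s_es_e^*$ for every $v\in X$. The ultragraph algebra is $C^*(\mathcal{G}):=C^*(\mathcal{G},\mathrm{Reg}(\mathcal{G}))$. The ultragraph $\mathcal{G}_X$: with $Y=\mathrm{Reg}(\mathcal{G})\setminus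 X$, let $Y'=\{y':y\in Y\}$ be a disjoint copy of $Y$, and for $D\subseteq Y$ write $D'=\{w':w\in D\}$. Put $\mathcal{G}_X^0=\mathcal{G}^0\cup Y'$, $\mathcal{G}_X^1=\mathcal{G}^1\cup\{e':e\in\mathcal{G}^1,\ r(e)\cap Y\ne\emptyset\}$ (the $e'$ being new edges), $s_X,r_X$ extend $s,r$, and $s_X(e')=s(e)$, $r_X(e')=(r(e)\cap Y)'$. $\mathcal{E}_X$ is the family $\mathcal{E}$ for $\mathcal{G}_X$. The canonical generators of $C^*(\mathcal{G}_X)$ are denoted $S_f$ ($f\in\mathcal{G}_X^1$), $P_Z$ ($Z\in\mathcal{E}_X$). For $A\in\mathcal{E}$ one has $(A\cap Y)'\in\mathcal{E}_X$; every $Z\in\mathcal{E}_X$ can be written $Z=A\cup(B\cap Y)'$ with $A,B\in\mathcal{E}$, where $A$ and $B\cap Y$ are unique. When all $r(e)\cap Y$ are finite, $A\cap Y$ is finite for every $A\in\mathcal{E}$, so the sums are finite; empty sums are $0$. *)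

(* Defs.v *)
From HB Require Import structures.
From mathcomp Require Import all_boot all_order all_algebra.
From mathcomp Require Import mathcomp_extra boolp classical_sets functions.
From mathcomp Require Import cardinality fsbigop reals.
From mathcomp Require Import topology normedtype.
From mathcomp Require Import complex.

Set Implicit Arguments.
Unset Strict Implicit.
Unset Printing Implicit Defensive.

Import Order.TTheory GRing.Theory Num.Theory.
Import numFieldNormedType.Exports.

Local Open Scope classical_set_scope.
Local Open Scope ring_scope.

(* Complex C*-algebras, not assumed to have a unit. MathComp's ring structures
   are all unital, so the product is a field of the mixin. As everywhere in
   MathComp-Analysis, the norm takes its (nonnegative) values in the scalar
   field, here R[i]. *)
HB.mixin Record CompleteNormedModule_isCStarAlgebra (R : realType) A
    of CompleteNormedModule R[i] A := {
  cmul : A -> A -> A ;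
  star : A -> A ;
  cmulA : associative cmul ;
  cmulDl : left_distributive cmul +%R ;
  cmulDr : right_distributive cmul +%R ;
  cmulZl : forall (k : R[i]) (a b : A), cmul (k *: a) b = k *: cmul a b ;
  cmulZr : forall (k : R[i]) (a b : A), cmul a (k *: b) = k *: cmul a b ;
  starK : involutive star ;
  starD : {morph star : a b / a + b} ;
  starZ : forall (k : R[i]) (a : A), star (k *: a) = k^* *: star a ;
  starM : forall a b : A, star (cmul a b) = cmul (star b) (star a) ;
  cmul_norm : forall a b : A, `|cmul a b| <= `|a| * `|b| ;
  cstar_norm : forall a : A, `|cmul (star a) a| = `|a| ^+ 2
}.

#[short(type="cstarAlgType")]
HB.structure Definition CStarAlgebra (R : realType) :=
  {A of CompleteNormedModule R[i] A & CompleteNormedModule_isCStarAlgebra R A}.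

Notation "a ** b" := (cmul a b) (at level 40, left associativity) : ring_scope.

Definition is_projection (R : realType) (A : cstarAlgType R) (p : A) : Prop :=
  star p = p /\ p ** p = p.

Definition is_partial_isometry (R : realType) (A : cstarAlgType R) (s : A)
  : Prop := s ** star s ** s = s.

(* p <= q for projections p and q, in the usual sense that the range of p is
   contained in that of q. *)
Definition proj_le (R : realType) (A : cstarAlgType R) (p q : A) : Prop :=
  p ** q = p.

(* No boundedness is required: *-homomorphisms between C*-algebras are
   automatically contractive. *)
Record star_hom (R : realType) (A B : cstarAlgType R) (f : A -> B) : Prop := {
  star_homD : {morph f : a b / a + b} ;
  star_homZ : forall (k : R[i]) (a : A), f (k *: a) = k *: f a ;
  star_homM : {morph f : a b / a ** b} ;
  star_hom_star : {morph f : a / star a} }.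

Record ultragraph := Ultragraph {
  vertex : countType ;
  edge : countType ;
  src : edge -> vertex ;
  rng : edge -> set vertex }.

Definition vertex_sets (G : ultragraph) : set (set (vertex G)) :=
  smallest [set F | setU_closed F /\ setI_closed F]
    ([set set0] `|` range (fun v : vertex G => [set v]) `|` range (@rng G)).

Definition out_edges (G : ultragraph) (v : vertex G) : set (edge G) :=
  [set e | src e = v].

Definition Reg (G : ultragraph) : set (vertex G) :=
  [set v | out_edges v !=set0 /\ finite_set (out_edges v)].

(* The families of generators have p : set (vertex G) -> A total, but only the
   values of p on vertex_sets G are ever constrained or used. *)
Record relative_family (G : ultragraph) (X : set (vertex G)) (R : realType)
    (A : cstarAlgType R) (s : edge G -> A) (p : set (vertex G) -> A) : Prop := {
  family_pisom : forall e, is_partial_isometry (s e) ;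
  family_orth : forall e f, e <> f ->
    (s e ** star (s e)) ** (s f ** star (s f)) = 0 ;
  family_proj : forall B, vertex_sets B -> is_projection (p B) ;
  family_set0 : p set0 = 0 ;
  family_setI : forall B C, vertex_sets B -> vertex_sets C ->
    p B ** p C = p (B `&` C) ;
  family_setU : forall B C, vertex_sets B -> vertex_sets C ->
    p (B `|` C) = p B + p C - p (B `&` C) ;
  family_rng : forall e, star (s e) ** s e = p (rng e) ;
  family_src : forall e, proj_le (s e ** star (s e)) (p [set src e]) ;
  family_sum : forall v, X v ->
    p [set v] = \sum_(e \in out_edges v) s e ** star (s e) }.

(* (A, s, p) is C*(G, X) with its canonical generators, which the universal
   property characterizes up to a unique isomorphism; uniqueness of the induced
   *-homomorphism amounts to A being generated by the s e and p B. *)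
Definition is_relative_algebra (G : ultragraph) (X : set (vertex G))
    (R : realType) (A : cstarAlgType R)
    (s : edge G -> A) (p : set (vertex G) -> A) : Prop :=
  relative_family X s p /\
  forall (D : cstarAlgType R) (t : edge G -> D) (q : set (vertex G) -> D),
    relative_family X t q ->
    exists! f : A -> D, [/\ star_hom f,
      forall e, f (s e) = t e &
      forall B, vertex_sets B -> f (p B) = q B].

Definition is_ultragraph_algebra (G : ultragraph) (R : realType)
    (A : cstarAlgType R) (s : edge G -> A) (p : set (vertex G) -> A) : Prop :=
  is_relative_algebra (@Reg G) s p.

Section PrimedUltragraph.
Variables (G : ultragraph) (X : set (vertex G)).

(* This set is written Y in the comments below. *)
Definition RegD : set (vertex G) := @Reg G `\` X.

Definition split_edges : set (edge G) :=
  [set e | rng e `&` RegD !=set0].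

(* inl is the inclusion of G into G_X, and inr w is the copy w' (or e'). *)
Definition primed_vertex : countType := (vertex G + RegD)%type.
Definition primed_edge : countType := (edge G + split_edges)%type.

Definition unprimed (B : set (vertex G)) : set primed_vertex := inl @` B.

(* D' for D a subset of Y *)
Definition primed (D : set (vertex G)) : set primed_vertex :=
  [set inr w | w in [set w : RegD | D (val w)]].

Definition primed_src (f : primed_edge) : primed_vertex :=
  match f with
  | inl e => inl (src e)
  | inr e' => inl (src (val e'))
  end.

Definition primed_rng (f : primed_edge) : set primed_vertex :=
  match f with
  | inl e => unprimed (rng e)
  | inr e' => primed (rng (val e') `&` RegD)
  end.

Definition primed_ultragraph : ultragraph :=
  {| vertex := primed_vertex ; edge := primed_edge ;
     src := primed_src ; rng := primed_rng |}.

End PrimedUltragraph.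

Arguments unprimed {G} X B.
Arguments primed {G} X D.

(* The formulas for phi and psi. Here (s, p) are the generators of C*(G, X) in
   A and (S, P) those of C*(G_X) in B. *)
Section Formulas.
Variables (G : ultragraph) (X : set (vertex G)) (R : realType).
Variables (A B : cstarAlgType R).
Variables (s : edge G -> A) (p : set (vertex G) -> A).
Variables (S : edge (primed_ultragraph X) -> B).
Variables (P : set (vertex (primed_ultragraph X)) -> B).
Let Y := RegD X.

Definition phi_formula (phi : A -> B) : Prop :=
  [/\ forall C, vertex_sets C ->
        phi (p C) = P (unprimed X C) + P (primed X (C `&` Y)),
      forall e, rng e `&` Y = set0 -> phi (s e) = S (inl e) &
      forall e' : split_edges X,
        phi (s (val e')) = S (inl (val e')) + S (inr e')].

Definition edge_sum (D : set (vertex G)) : A :=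
  \sum_(g \in [set g | D (src g)]) s g ** star (s g).

Definition gap (w : vertex G) : A :=
  p [set w] - \sum_(g \in out_edges w) s g ** star (s g).

Definition psi_formula (psi : B -> A) : Prop :=
  [/\ forall (Z : set (vertex (primed_ultragraph X))) (C D : set (vertex G)),
        vertex_sets Z -> vertex_sets C -> vertex_sets D ->
        Z = unprimed X C `|` primed X (D `&` Y) ->
        psi (P Z) = p C - p (C `&` Y) + edge_sum (C `&` Y)
                    + \sum_(w \in D `&` Y) gap w,
      forall e, psi (S (inl e)) =
        s e ** (p (rng e) - p (rng e `&` Y) + edge_sum (rng e `&` Y)) &
      forall e' : split_edges X, psi (S (inr e')) =
        s (val e') ** (p (rng (val e') `&` Y) - edge_sum (rng (val e') `&` Y))].

End Formulas.

(* Main.v *)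
Require Import Defs.
From mathcomp Require Import all_boot all_order all_algebra.
From mathcomp Require Import finmap.
From mathcomp Require Import boolp classical_sets cardinality reals.
From mathcomp Require Import functions fsbigop.

Set Implicit Arguments.
Unset Strict Implicit.
Unset Printing Implicit Defensive.

Import GRing.Theory.

Local Open Scope classical_set_scope.
Local Open Scope ring_scope.

(** Put Y = Reg(G) minus X. For w in Y, C*(G, X) does not impose that p_w is
    the sum of the s_g s_g^* over the edges g leaving w; the gap q_w, the part
    of p_w orthogonal to all of these, measures the failure. In C*(G_X) the
    vertex w does satisfy the relation, and q_w reappears as the projection of
    the new sink w'. Thus p_w corresponds to P_w + P_{w'}, with P_w the part
    exhausted by edges and P_{w'} the gap. An edge e is cut in the same way on
    its range side, into the piece S_e that arrives at old vertices, where only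
    the exhausted parts are left, and the piece S_{e'} that arrives at the gaps.

    Both universal properties then apply. In C*(G, X) the gaps are mutually
    orthogonal projections, absorbed by p_C if w is in C and killed by it
    otherwise, and they kill every s_e ([gap_set], [gap_gap], [gap_mul]). As
    every C of the lattice meets Y in a finite set, the gaps in C have a sum Q,
    and p_C - Q and Q behave as the projections of a set of old vertices and of
    a set of new ones. By [split_family] the pieces satisfy the relations of
    G_X, which gives psi. Conversely, adding up in C*(G_X) the two copies of
    everything gives a family for (G, X), [merged_family], hence phi; as X lies
    in Reg(G), a vertex of X stays regular in G_X and has no copy, so its
    summation relation survives.

    Cutting and merging undo each other on generators ([phi_split_set],
    [phi_split_edge], [psi_merged_set], [psi_merged_edge]), so phi and psi are
    inverse to each other, because maps out of a universal algebra are
    determined by the generators. The same reason makes psi unique, once one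
    knows that every set of the lattice of G_X has the form that the formula
    for psi speaks of ([psi_formulaP]). *)

(** * Finite sums *)

Section FiniteSums.

Lemma morph_fsum (I : choiceType) (U V : zmodType) (f : U -> V) (D : set I)
    (F : I -> U) :
  {morph f : a b / a + b} -> finite_set D ->
  f (\sum_(i \in D) F i) = \sum_(i \in D) f (F i).
Proof.
move=> fD finD; rewrite !fsbig_finite//; apply: big_morph => //.
by apply: (addIr (f 0)); rewrite -fD !add0r.
Qed.

Lemma addrDBACA (V : zmodType) (a b c x y z : V) :
  (a + b - c) + (x + y - z) = (a + x) + (b + y) - (c + z).
Proof. by rewrite addrACA (addrACA a) -opprD. Qed.

Lemma subrDBACA (V : zmodType) (a b c x y z : V) :
  (a + b - c) - (x + y - z) = (a - x) + (b - y) - (c - z).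
Proof. by rewrite opprD addrACA (opprD x) (addrACA a) -opprD. Qed.

Lemma fsumU (I : choiceType) (V : zmodType) (C D : set I) (F : I -> V) :
  finite_set C -> finite_set D ->
  \sum_(i \in C `|` D) F i =
  \sum_(i \in C) F i + \sum_(i \in D) F i - \sum_(i \in C `&` D) F i.
Proof.
move=> finC finD; rewrite (fsbigID C (C `|` D)) ?finite_setU//=.
rewrite setUK setIUl setICr set0U.
rewrite -addrA; congr (_ + _); rewrite (fsbigID C D)//= (setIC C).
by rewrite addrAC subrr add0r.
Qed.

Lemma finite_set_ind (I : choiceType) (K : set I -> Prop) :
  K set0 ->
  (forall x D, finite_set D -> ~ D x -> K D -> K (x |` D)) ->
  forall D, finite_set D -> K D.
Proof.
move=> K0 KU D /finite_fsetP [F ->] {D}.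
elim/finSet_rect: F => F IH.
have [->|[x xF]] := fset_0Vmem F; first by rewrite set_fset0.
rewrite -(fsetD1K xF) set_fsetU set_fset1.
apply: KU => //; first by rewrite /= !inE eqxx.
by apply: IH; exact: fproperD1.
Qed.

End FiniteSums.

(** * Algebra without a unit *)

Section CStarAlgebraTheory.
Variables (R : realType) (A : cstarAlgType R).
Implicit Types a b c : A.

Lemma cmul0r a : a ** 0 = 0.
Proof. by apply: (addIr (a ** 0)); rewrite -cmulDr !add0r. Qed.

Lemma cmul0l a : 0 ** a = 0.
Proof. by apply: (addIr (0 ** a)); rewrite -cmulDl !add0r. Qed.

Lemma cmulNr a b : a ** (- b) = - (a ** b).
Proof. by apply: (addIr (a ** b)); rewrite -cmulDr !addNr cmul0r. Qed.

Lemma cmulNl a b : (- a) ** b = - (a ** b).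
Proof. by apply: (addIr (a ** b)); rewrite -cmulDl !addNr cmul0l. Qed.

Lemma cmulBr a b c : a ** (b - c) = a ** b - a ** c.
Proof. by rewrite cmulDr cmulNr. Qed.

Lemma cmulBl a b c : (a - b) ** c = a ** c - b ** c.
Proof. by rewrite cmulDl cmulNl. Qed.

Lemma star0 : star (0 : A) = 0.
Proof. by apply: (addIr (star 0)); rewrite -starD !add0r. Qed.

Lemma starN a : star (- a) = - star a.
Proof. by apply: (addIr (star a)); rewrite -starD !addNr star0. Qed.

Lemma starB a b : star (a - b) = star a - star b.
Proof. by rewrite starD starN. Qed.

Variable I : choiceType.
Implicit Types (D : set I) (F : I -> A).

Lemma cmul_fsumr a D F : finite_set D ->
  a ** (\sum_(i \in D) F i) = \sum_(i \in D) a ** F i.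
Proof. by move=> finD; apply: morph_fsum => // b c; exact: cmulDr. Qed.

Lemma cmul_fsuml a D F : finite_set D ->
  (\sum_(i \in D) F i) ** a = \sum_(i \in D) F i ** a.
Proof.
by move=> finD; apply: (morph_fsum (f := cmul^~ a)) => // b c; exact: cmulDl.
Qed.

Lemma star_fsum D F : finite_set D ->
  star (\sum_(i \in D) F i) = \sum_(i \in D) star (F i).
Proof. by move=> finD; apply: morph_fsum => // b c; exact: starD. Qed.

End CStarAlgebraTheory.

Section StarHomTheory.
Variables (R : realType) (A B : cstarAlgType R) (f : A -> B).
Hypothesis hf : star_hom f.

Lemma star_homN a : f (- a) = - f a.
Proof.
have f0 : f 0 = 0 by apply: (addIr (f 0)); rewrite -star_homD// !add0r.
by apply: (addIr (f a)); rewrite -star_homD// !addNr.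
Qed.

Lemma star_homB a b : f (a - b) = f a - f b.
Proof. by rewrite star_homD// star_homN. Qed.

Lemma star_hom_fsum (I : choiceType) (D : set I) (F : I -> A) : finite_set D ->
  f (\sum_(i \in D) F i) = \sum_(i \in D) f (F i).
Proof. by move=> finD; apply: morph_fsum => // a b; exact: star_homD. Qed.

End StarHomTheory.

Lemma star_hom_comp (R : realType) (A B C : cstarAlgType R) (g : B -> C)
  (f : A -> B) : star_hom g -> star_hom f -> star_hom (g \o f).
Proof.
by move=> hg hf; split=> [a b|k a|a b|a] /=;
  rewrite ?star_homD ?star_homZ ?star_homM ?star_hom_star.
Qed.

(** * The lattice of vertex sets *)

Section VertexSets.
Variable G : ultragraph.
Implicit Types (C D : set (vertex G)).

Lemma vertex_sets_gen C :
  ([set set0] `|` range (fun v : vertex G => [set v]) `|` range (@rng G)) C ->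
  vertex_sets C.
Proof. exact: sub_gen_smallest. Qed.

Lemma vertex_sets0 : vertex_sets (set0 : set (vertex G)).
Proof. by apply: vertex_sets_gen; left; left. Qed.

Lemma vertex_sets1 v : vertex_sets [set v : vertex G].
Proof. by apply: vertex_sets_gen; left; right; exists v. Qed.

Lemma vertex_sets_rng e : vertex_sets (@rng G e).
Proof. by apply: vertex_sets_gen; right; exists e. Qed.

Lemma vertex_setsU C D :
  vertex_sets C -> vertex_sets D -> vertex_sets (C `|` D).
Proof.
move=> hC hD F hF; have [[FU _] _] := hF.
by apply: FU; [exact: hC|exact: hD].
Qed.

Lemma vertex_setsI C D :
  vertex_sets C -> vertex_sets D -> vertex_sets (C `&` D).
Proof.
move=> hC hD F hF; have [[_ FI] _] := hF.
by apply: FI; [exact: hC|exact: hD].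
Qed.

Lemma vertex_sets_finite C : finite_set C -> vertex_sets C.
Proof.
move: C; apply: finite_set_ind; first exact: vertex_sets0.
by move=> x D _ _ hD; apply: vertex_setsU => //; exact: vertex_sets1.
Qed.

Lemma vertex_sets_ind (K : set (vertex G) -> Prop) :
  K set0 -> (forall v, K [set v]) -> (forall e, K (rng e)) ->
  (forall C D, K C -> K D -> K (C `|` D)) ->
  (forall C D, K C -> K D -> K (C `&` D)) ->
  forall C, vertex_sets C -> K C.
Proof.
move=> K0 K1 Kr KU KI; apply: (smallest_sub (X := K)); first by split.
by move=> C [[->//|[v _ <-]]|[e _ <-]].
Qed.

End VertexSets.

(** * Gap projections *)

Section RelativeFamily.
Variables (G : ultragraph) (X : set (vertex G)) (R : realType).
Variables (A : cstarAlgType R) (s : edge G -> A) (p : set (vertex G) -> A).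
Hypothesis fam : relative_family X s p.
Implicit Types (C D : set (vertex G)) (v w : vertex G) (e f : edge G).

Local Notation gap := (gap s p).

Lemma family_star C : vertex_sets C -> star (p C) = p C.
Proof. by case/(family_proj fam). Qed.

(** In adjoint form the relation on sources says that p_(s(e)) fixes s_e; this is
    how it is used everywhere below. *)
Lemma family_src_mul e : p [set src e] ** s e = s e.
Proof.
have /(congr1 star) := family_src fam e.
rewrite !starM starK family_star => [h|]; last exact: vertex_sets1.
by rewrite -[in LHS](family_pisom fam e) cmulA h (family_pisom fam e).
Qed.

Lemma family_rng_mul e : s e ** p (rng e) = s e.
Proof. by rewrite -(family_rng fam) cmulA; exact: (family_pisom fam). Qed.

(** Orthogonality of the ranges, with the partial isometries cancelled on both
    sides. *)
Lemma family_star_mul0 e f : e <> f -> star (s e) ** s f = 0.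
Proof.
move=> ef; have h : star (s e) = star (s e) ** (s e ** star (s e)).
  by rewrite -{1}(family_pisom fam e) !starM starK cmulA.
rewrite h -(family_pisom fam f) cmulA -(cmulA (star (s e))).
by rewrite (family_orth fam ef) cmul0r cmul0l.
Qed.

Lemma family_set_mul C e : vertex_sets C ->
  p C ** s e = if src e \in C then s e else 0.
Proof.
move=> hC; have h1 := vertex_sets1 (src e).
rewrite -{1}(family_src_mul e) cmulA (family_setI fam)//.
case: ifPn; rewrite (inE, notin_setE) => hv.
  by rewrite setIidr ?family_src_mul// => ? ->.
suff -> : C `&` [set src e] = set0 by rewrite (family_set0 fam) cmul0l.
by rewrite -subset0 => ? [hv' /= e'] ; apply: hv; rewrite -e'.
Qed.

Lemma family_set_set1 C w : vertex_sets C ->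
  p C ** p [set w] = if w \in C then p [set w] else 0.
Proof.
move=> hC; rewrite (family_setI fam)//; last exact: vertex_sets1.
case: ifPn; rewrite (inE, notin_setE) => hv.
  by rewrite setIidr// => ? ->.
rewrite (_ : _ `&` _ = set0) ?(family_set0 fam)// -subset0 => ? [hv' /= e'].
by apply: hv; rewrite -e'.
Qed.

Lemma family_split C D : vertex_sets C -> vertex_sets D -> C `&` D = set0 ->
  p (C `|` D) = p C + p D.
Proof.
by move=> hC hD CD0; rewrite (family_setU fam)// CD0 (family_set0 fam) subr0.
Qed.

Section Gap.
Variables (w : vertex G) (regw : Reg w).
Let finw : finite_set (out_edges w) := proj2 regw.

(** The projection p_w and the sum of the s_g s_g^* over the edges leaving w act
    alike on every s_e: as the identity if e leaves w, as 0 otherwise. *)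
Lemma gap_mul e : gap w ** s e = 0.
Proof.
rewrite cmulBl family_set_mul; last exact: vertex_sets1.
rewrite cmul_fsuml//; apply/eqP; rewrite subr_eq0; apply/eqP.
case: ifPn; rewrite (inE, notin_setE) => /= hv.
  rewrite (fsbigD1 e)//= fsbig1 ?addr0 ?(family_pisom fam e)// => f [_ fe].
  by rewrite -cmulA family_star_mul0// cmul0r.
rewrite fsbig1// => f fw; rewrite -cmulA family_star_mul0 ?cmul0r// => fe.
by apply: hv; rewrite -fe fw.
Qed.

Lemma star_gap : star (gap w) = gap w.
Proof.
rewrite starB family_star; last exact: vertex_sets1.
rewrite star_fsum//; congr (_ - _); apply: eq_fsbigr => e _.
by rewrite starM starK.
Qed.

(** The sum in the gap lives under p_w, so p_C acts on both terms through whether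
    w lies in C. *)
Lemma family_set_gap C : vertex_sets C ->
  p C ** gap w = if w \in C then gap w else 0.
Proof.
move=> hC; rewrite cmulBr family_set_set1// cmul_fsumr//.
rewrite (eq_fsbigr
  (fun e => if w \in C then s e ** star (s e) else 0)) => [|e].
  by case: ifP => // _; rewrite fsbig1 ?subr0.
rewrite inE /= /out_edges /= => <-; rewrite cmulA family_set_mul//.
by case: ifP => // _; rewrite cmul0l.
Qed.

Lemma gap_set C : vertex_sets C ->
  gap w ** p C = if w \in C then gap w else 0.
Proof.
move=> hC; apply: (can_inj (@starK _ A)).
rewrite starM star_gap family_star// family_set_gap//.
by case: ifP; rewrite ?star_gap ?star0.
Qed.

End Gap.

(** Multiplying by the gap at w amounts to multiplying by p_w, since the gap at v
    kills all the s_e occurring in the correction term. *)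
Lemma gap_gap v w : Reg v -> Reg w ->
  gap v ** gap w = if v \in [set w] then gap v else 0.
Proof.
move=> hv hw; rewrite cmulBr gap_set//; last exact: vertex_sets1.
have finw : finite_set (out_edges w) by case: hw.
rewrite cmul_fsumr// fsbig1 ?subr0// => e _.
by rewrite cmulA gap_mul// cmul0l.
Qed.

Definition gap_sum D : A := \sum_(w \in D) gap w.

(** The sets for which the sum of gaps makes sense: summation over an infinite
    support returns 0 by convention, and the gap at w sums over the edges leaving
    w. *)
Definition finite_regular D := finite_set D /\ D `<=` @Reg G.

Lemma finite_regularIl C D : finite_regular D -> finite_regular (C `&` D).
Proof.
by case=> fD rD; split; [exact: finite_setIr|move=> x [_ /rD]].
Qed.

Lemma star_gap_sum D : finite_regular D -> star (gap_sum D) = gap_sum D.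
Proof.
case=> fD rD; rewrite star_fsum//; apply: eq_fsbigr => w.
by rewrite inE => /rD; exact: star_gap.
Qed.

Lemma gap_sum_mul D e : finite_regular D -> gap_sum D ** s e = 0.
Proof.
by case=> fD rD; rewrite cmul_fsuml// fsbig1// => w /rD hw; exact: gap_mul.
Qed.

Lemma family_set_gap_sum C D : vertex_sets C -> finite_regular D ->
  p C ** gap_sum D = gap_sum (C `&` D).
Proof.
move=> hC [fD rD]; rewrite cmul_fsumr// /gap_sum fsbig_mkcondl.
by apply: eq_fsbigr => w; rewrite inE => /rD hw; exact: family_set_gap.
Qed.

Lemma gap_sum_set C D : vertex_sets C -> finite_regular D ->
  gap_sum D ** p C = gap_sum (C `&` D).
Proof.
move=> hC hD; apply: (can_inj (@starK _ A)).
rewrite starM star_gap_sum// family_star// family_set_gap_sum//.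
by rewrite star_gap_sum//; exact: finite_regularIl.
Qed.

Lemma gap_sum_gap_sum C D : finite_regular C -> finite_regular D ->
  gap_sum C ** gap_sum D = gap_sum (C `&` D).
Proof.
move=> [fC rC] [fD rD]; rewrite cmul_fsuml// /gap_sum fsbig_mkcondr.
apply: eq_fsbigr => v; rewrite inE => /rC hv; rewrite cmul_fsumr//.
rewrite (eq_fsbigr (fun w => if w \in [set v] then gap v else 0)).
  rewrite -fsbig_mkcondr; case: ifPn; rewrite (inE, notin_setE) => Dv.
    by rewrite setIidr ?fsbig_set1// => ? ->.
  by rewrite fsbig1// => w [/[swap] /= ->].
move=> w; rewrite inE => /rD hw; rewrite gap_gap//.
by rewrite !in_set1 eq_sym.
Qed.

Lemma gap_sum0 : gap_sum set0 = 0.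
Proof. exact: fsbig_set0. Qed.

Lemma gap_sumU C D : finite_regular C -> finite_regular D ->
  gap_sum (C `|` D) = gap_sum C + gap_sum D - gap_sum (C `&` D).
Proof. by move=> [fC _] [fD _]; exact: fsumU. Qed.

Lemma finite_edge_sum D : finite_regular D ->
  finite_set [set g | D (@src G g)].
Proof.
case=> fD rD; rewrite (_ : [set _ | _] = \bigcup_(w in D) (@out_edges G w)).
  by apply: bigcup_finite => // w /rD [].
by apply/seteqP; split=> [g Dg|g [w Dw wg]]; [exists (src g)|rewrite /= wg].
Qed.

(** The formulas for psi are written with p_D and the sum over all the edges
    leaving D; both are additive over the points of D, and their difference is a
    sum of gaps. *)
Lemma family_set_edge_sum D : finite_regular D ->
  p D - edge_sum s D = gap_sum D.
Proof.
case=> fD; elim/finite_set_ind: fD => [|w {}D fD Dw IH] rD.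
  rewrite (family_set0 fam) gap_sum0 sub0r /edge_sum.
  by rewrite (_ : [set _ | _] = set0) ?fsbig_set0 ?oppr0.
have rD' : D `<=` @Reg G by move=> v Dv; apply: rD; right.
have regw : Reg w by apply: rD; left.
have disj : [set w] `&` D = set0 by rewrite -subset0 => v [/= vw]; rewrite vw.
rewrite family_split//; [|exact: vertex_sets1|exact: vertex_sets_finite].
rewrite /gap_sum fsbigU0 ?disj// fsbig_set1 -/(gap_sum D) -IH// /edge_sum.
rewrite (_ : [set g | (w |` D) (src g)] =
  out_edges w `|` [set g | D (src g)])// fsbigU0//.
- by rewrite opprD addrACA.
- exact: (proj2 regw).
- exact: finite_edge_sum.
- by move=> g [/= -> /Dw].
Qed.

End RelativeFamily.

(** * Vertex sets and edges of the primed ultragraph *)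

Section PrimedUltragraphTheory.
Variables (G : ultragraph) (X : set (vertex G)).
Hypothesis finY : forall e : edge G, finite_set (rng e `&` RegD X).
Implicit Types (C D : set (vertex G)).

Local Notation Y := (RegD X).
Local Notation GX := (primed_ultragraph X).
Implicit Types (Z W : set (vertex GX)).

Definition lower Z : set (vertex G) := [set v | Z (inl v)].

Definition upper Z : set (vertex G) :=
  [set val w | w in [set w : Y | Z (inr w)]].

(** The inverse image of C under the map of G_X onto G that forgets primes. It is
    the union of C and of the copies of the points of C in Y, and being an inverse
    image it commutes with unions and intersections by definition. *)
Definition doubled C : set (vertex GX) :=
  [set z : vertex GX | C (match z with inl v => v | inr w => val w end)].

(** Only the generators r(e) could be infinite in Y, and the hypothesis excludes
    it; finiteness then passes to unions and intersections. *)
Lemma vertex_sets_finite_regular C : vertex_sets C ->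
  finite_regular (C `&` Y).
Proof.
move=> hC; split=> [|v [_ []]//]; move: C hC; apply: vertex_sets_ind => //.
- by rewrite set0I.
- by move=> v; apply: finite_setIl.
- by move=> C D hC hD; rewrite setIUl finite_setU.
- by move=> C D hC hD; rewrite -setIA; exact: finite_setIr.
Qed.

Lemma RegD_val (w : Y) : Y (val w).
Proof. exact: (set_mem (valP w)). Qed.

Lemma upper_sub Z : upper Z `<=` Y.
Proof. by move=> _ [w _ <-]; exact: RegD_val. Qed.

Lemma upperE Z (w : Y) : upper Z (val w) = Z (inr w).
Proof.
by apply/propext; split=> [[u Zu /val_inj <-]|Zw]//; exists w.
Qed.

Lemma unprimed_primedE C D :
  unprimed X C `|` primed X D =
  [set z | match z with inl v => C v | inr w => D (val w) end].
Proof.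
apply/seteqP; split=> [z [[v Cv <-]|[w Dw <-]]//|[v Cv|w Dw]].
- by left; exists v.
- by right; exists w.
Qed.

Lemma doubledE C : doubled C = unprimed X C `|` primed X (C `&` Y).
Proof.
rewrite unprimed_primedE; apply/seteqP; split=> -[v|w] //=.
- by move=> Cw; split=> //; exact: RegD_val.
- by case.
Qed.

Lemma lower_unprimed_primed C D : lower (unprimed X C `|` primed X D) = C.
Proof. by rewrite unprimed_primedE. Qed.

Lemma upper_unprimed_primed C D :
  upper (unprimed X C `|` primed X (D `&` Y)) = D `&` Y.
Proof.
rewrite unprimed_primedE; apply/seteqP; split=> [_ [w /= Dw <-]//|v [Dv Yv]].
by exists (exist _ v (mem_set Yv)).
Qed.

Lemma lower_upperE Z : unprimed X (lower Z) `|` primed X (upper Z) = Z.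
Proof.
by rewrite unprimed_primedE; apply/seteqP; split=> -[v|w]//=; rewrite upperE.
Qed.

Lemma lowerI Z W : lower (Z `&` W) = lower Z `&` lower W. Proof. by []. Qed.

Lemma lowerU Z W : lower (Z `|` W) = lower Z `|` lower W. Proof. by []. Qed.

Lemma upperI Z W : upper (Z `&` W) = upper Z `&` upper W.
Proof.
apply/seteqP; split=> [_ [w [Zw Ww] <-]|_ [[w Zw <-]]].
  by rewrite /= !upperE.
by rewrite upperE => Ww; exists w.
Qed.

Lemma upperU Z W : upper (Z `|` W) = upper Z `|` upper W.
Proof.
apply/seteqP; split=> [_ [w [Zw|Ww] <-]|_ [[w Zw <-]|[w Ww <-]]].
- by left; rewrite upperE.
- by right; rewrite upperE.
- by exists w => //; left.
- by exists w => //; right.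
Qed.

Lemma unprimed_vertex_sets C : vertex_sets C ->
  vertex_sets (unprimed X C : set (vertex GX)).
Proof.
move: C; apply: vertex_sets_ind.
- by rewrite /unprimed image_set0; exact: vertex_sets0.
- by move=> v; rewrite /unprimed image_set1; exact: vertex_sets1.
- by move=> e; exact: (vertex_sets_rng (inl e : edge GX)).
- by move=> C D hC hD; rewrite /unprimed image_setU; exact: vertex_setsU.
- move=> C D hC hD; rewrite (_ : unprimed X _ = unprimed X C `&` unprimed X D).
    exact: vertex_setsI.
  apply/seteqP; split=> [_ [v [Cv Dv] <-]|_ [[v Cv <-] [w Dw [wv]]]].
    by split; exists v.
  by exists v => //; split=> //; rewrite -wv.
Qed.

Lemma primed_vertex_sets C : vertex_sets C ->
  vertex_sets (primed X (C `&` Y) : set (vertex GX)).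
Proof.
move=> /vertex_sets_finite_regular [fC _]; apply: vertex_sets_finite.
apply: finite_image.
apply: (@finite_preimage _ _ _ (val : Y -> vertex G)) => //.
exact: in2W val_inj.
Qed.

Lemma doubled_vertex_sets C : vertex_sets C -> vertex_sets (doubled C).
Proof.
move=> hC; rewrite doubledE; apply: vertex_setsU.
  exact: unprimed_vertex_sets.
exact: primed_vertex_sets.
Qed.

Lemma lower_vertex_sets Z : vertex_sets Z -> vertex_sets (lower Z).
Proof.
move: Z; apply: vertex_sets_ind.
- exact: vertex_sets0.
- move=> [v|w].
    rewrite (_ : lower _ = [set v]); first exact: vertex_sets1.
    by apply/seteqP; split=> [u [->]|u ->].
  rewrite (_ : lower _ = set0); first exact: vertex_sets0.
  by rewrite -subset0.
- move=> [e|e'] /=.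
    rewrite (_ : lower _ = rng e); first exact: vertex_sets_rng.
    by apply/seteqP; split=> [u [v rv [<-]]|u ru]//; exists u.
  rewrite (_ : lower _ = set0); first exact: vertex_sets0.
  by rewrite -subset0 => v [].
- by move=> Z W; exact: vertex_setsU.
- by move=> Z W; exact: vertex_setsI.
Qed.

Lemma upper_finite_regular Z : vertex_sets Z -> finite_regular (upper Z).
Proof.
move=> hZ; split=> [|v /upper_sub []//]; move: Z hZ; apply: vertex_sets_ind.
- by rewrite (_ : upper _ = set0)// -subset0 => a [w [] //].
- move=> z; apply: finite_image.
  apply: (@finite_preimage _ _ _ (inr : Y -> vertex GX)) => //.
  exact: in2W inr_inj.
- case=> [e|e'].
    rewrite (_ : upper _ = set0)// -subset0 => a [w [v _]] //.
  apply: sub_finite_set (finY (val e')) => a [w [u Du h] <-].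
  by rewrite -(inr_inj h).
- by move=> Z W hZ hW; rewrite upperU finite_setU.
- by move=> Z W hZ hW; rewrite upperI; exact: finite_setIr.
Qed.

Lemma out_edges_inl v : @out_edges GX (inl v) =
  inl @` out_edges v `|` inr @` [set e' : split_edges X | src (val e') = v].
Proof.
apply/seteqP; split=> [[e|e'] [ev]|f [[e /= ev <-]|[e' /= ev <-]]].
- by left; exists e.
- by right; exists e'.
- by rewrite /out_edges /= ev.
- by rewrite /out_edges /= ev.
Qed.

(** Each edge leaving v has at most one copy, so the number of edges leaving v
    stays finite and nonzero. *)
Lemma Reg_inl v : @Reg GX (inl v) <-> Reg v.
Proof.
rewrite /Reg /= out_edges_inl; split=> -[ne fin]; split.
- case: ne => f [[e ev _]|[e' ev _]]; first by exists e.
  by exists (val e').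
- move: fin; rewrite finite_setU => -[fin _].
  apply: sub_finite_set (finite_preimage _ fin) => [e ev|].
    by exists e.
  exact: in2W inl_inj.
- by case: ne => e ev; exists (inl e); left; exists e.
- rewrite finite_setU; split; first exact: finite_image.
  apply: finite_image.
  apply: (@finite_preimage _ _ _ (val : split_edges X -> edge G)) fin.
  exact: in2W val_inj.
Qed.

Lemma Reg_inr w : ~ @Reg GX (inr w).
Proof. by case=> -[[e|e'] []]. Qed.

(** A sum over the edges of G_X leaving v is taken over the edges of G leaving v,
    by extending the terms of the primed edges by 0 to the edges without copy. *)
Lemma fsum_out_edges_inl (V : zmodType) (F : edge GX -> V)
    (F' : edge G -> V) v :
  finite_set (out_edges v) ->
  (forall e' : split_edges X, F (inr e') = F' (val e')) ->
  (forall e, rng e `&` Y = set0 -> F' e = 0) ->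
  \sum_(f \in @out_edges GX (inl v)) F f =
  \sum_(e \in out_edges v) (F (inl e) + F' e).
Proof.
move=> fin FF' F'0.
have fin' : finite_set [set e' : split_edges X | src (val e') = v].
  apply: (@finite_preimage _ _ _ (val : split_edges X -> edge G)) fin.
  exact: in2W val_inj.
rewrite out_edges_inl fsbigU0; last 3 first.
- exact: finite_image.
- exact: finite_image.
- by move=> _ [[e _ <-] []].
rewrite fsbig_split//; congr (_ + _).
  by rewrite fsbig_image//; exact: in2W inl_inj.
rewrite fsbig_image; last exact: in2W inr_inj.
rewrite (eq_fsbigr (F' \o val)) => [|e' _]; last exact: FF'.
rewrite -(fsbig_image _ (val : split_edges X -> edge G)); last first.
  exact: in2W val_inj.
apply: fsbig_widen => [_ [e' ev <-]//|e [ev ne]].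
apply: F'0; rewrite -subset0 => w rw; apply: ne.
have re : split_edges X e by exists w.
by exists (exist _ e (mem_set re)).
Qed.

End PrimedUltragraphTheory.

Arguments doubled {G} X C _.

(** * Splitting: a family for the primed ultragraph *)

Section InverseFamily.
Variables (G : ultragraph) (X : set (vertex G)).
Hypothesis finY : forall e : edge G, finite_set (rng e `&` RegD X).
Variables (R : realType) (A : cstarAlgType R).
Variables (s : edge G -> A) (p : set (vertex G) -> A).
Hypothesis fam : relative_family X s p.

Local Notation Y := (RegD X).
Local Notation GX := (primed_ultragraph X).
Local Notation Q := (gap_sum s p).
Implicit Types (C D : set (vertex G)) (Z W : set (vertex GX)).

(** What remains of p_C for the old vertices in C once the gaps at the points of
    Y have gone to the new ones. *)
Definition truncated C : A := p C - Q (C `&` Y).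

Definition split_set Z : A := truncated (lower Z) + Q (upper Z).

Definition base_edge (f : edge GX) : edge G :=
  match f with inl e => e | inr e' => val e' end.

(** The ranges of e and e' partition the doubled range of e, so cutting s_e on its
    range side by the projections of these ranges treats e and e' alike. *)
Definition split_edge (f : edge GX) : A :=
  s (base_edge f) ** split_set (rng f).

Let finreg C : vertex_sets C -> finite_regular (C `&` Y).
Proof. exact: vertex_sets_finite_regular. Qed.

Let upreg Z : vertex_sets Z -> finite_regular (upper Z).
Proof. exact: upper_finite_regular. Qed.

Let low Z : vertex_sets Z -> vertex_sets (lower Z).
Proof. exact: lower_vertex_sets. Qed.

Lemma truncatedE C : vertex_sets C ->
  truncated C = p C - p (C `&` Y) + edge_sum s (C `&` Y).
Proof.
move=> hC; rewrite /truncated -(family_set_edge_sum fam (finreg hC)).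
by rewrite opprB addrA addrAC.
Qed.

Lemma truncated0 : truncated set0 = 0.
Proof. by rewrite /truncated set0I gap_sum0 (family_set0 fam) subr0. Qed.

Lemma star_truncated C : vertex_sets C -> star (truncated C) = truncated C.
Proof.
move=> hC; have fC := finreg hC.
by rewrite starB (family_star fam)// (star_gap_sum fam).
Qed.

Lemma truncatedM C D : vertex_sets C -> vertex_sets D ->
  truncated C ** truncated D = truncated (C `&` D).
Proof.
move=> hC hD; have fC := finreg hC; have fD := finreg hD.
rewrite cmulBr !cmulBl (family_setI fam)// (gap_sum_set fam)//.
rewrite (family_set_gap_sum fam)// (gap_sum_gap_sum fam)//.
by rewrite /truncated -setIIl !setIA (setIC D C) subrr subr0.
Qed.

Lemma truncated_gap_sum C D : vertex_sets C -> finite_regular D -> D `<=` Y ->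
  truncated C ** Q D = 0.
Proof.
move=> hC hD DY; have fC := finreg hC.
rewrite cmulBl (family_set_gap_sum fam)// (gap_sum_gap_sum fam)// -setIA.
by rewrite (setIC Y) (setIidl DY) subrr.
Qed.

(** Nothing is lost by truncating on the source side, as gaps kill the edges. *)
Lemma truncated_src C e : vertex_sets C -> C (src e) ->
  truncated C ** s e = s e.
Proof.
move=> hC Ce; have fC := finreg hC.
rewrite cmulBl (gap_sum_mul fam)// subr0.
by rewrite (family_set_mul fam)// mem_set.
Qed.

Lemma truncatedU C D : vertex_sets C -> vertex_sets D ->
  truncated (C `|` D) = truncated C + truncated D - truncated (C `&` D).
Proof.
move=> hC hD; have fC := finreg hC; have fD := finreg hD.
rewrite /truncated setIUl gap_sumU// (family_setU fam)//.
by rewrite -setIIl; exact: subrDBACA.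
Qed.

(** The gaps removed from p_C at the old vertices come back at their copies. *)
Lemma split_set_doubled C : split_set (doubled X C) = p C.
Proof.
rewrite /split_set doubledE lower_unprimed_primed upper_unprimed_primed.
exact: subrK.
Qed.

Lemma split_set_unprimed C : split_set (unprimed X C) = truncated C.
Proof.
have -> : unprimed X C = unprimed X C `|` primed X (set0 `&` Y).
  by rewrite (_ : primed X _ = set0) ?setU0// set0I -subset0 => z [].
rewrite /split_set lower_unprimed_primed upper_unprimed_primed set0I.
by rewrite gap_sum0 addr0.
Qed.

Lemma split_set_primed C : split_set (primed X (C `&` Y)) = Q (C `&` Y).
Proof.
have -> : primed X (C `&` Y) = unprimed X set0 `|` primed X (C `&` Y).
  by rewrite /unprimed image_set0 set0U.
rewrite /split_set lower_unprimed_primed upper_unprimed_primed.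
by rewrite truncated0 add0r.
Qed.

Lemma star_split_set Z : vertex_sets Z -> star (split_set Z) = split_set Z.
Proof.
move=> hZ; have uZ := upreg hZ; have lZ := low hZ.
by rewrite starD star_truncated// (star_gap_sum fam).
Qed.

Lemma gap_sum_truncated C D : vertex_sets C -> finite_regular D -> D `<=` Y ->
  Q D ** truncated C = 0.
Proof.
move=> hC hD DY; apply: (can_inj (@starK _ A)).
rewrite starM star_truncated// (star_gap_sum fam)//.
by rewrite truncated_gap_sum// star0.
Qed.

Lemma split_setM Z W : vertex_sets Z -> vertex_sets W ->
  split_set Z ** split_set W = split_set (Z `&` W).
Proof.
move=> hZ hW; have uZ := upreg hZ; have lZ := low hZ.
have uW := upreg hW; have lW := low hW.
have [sZ sW] := (@upper_sub _ _ Z, @upper_sub _ _ W).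
rewrite cmulDr !(cmulDl (truncated _)) truncatedM//.
rewrite gap_sum_truncated// truncated_gap_sum//.
by rewrite addr0 add0r (gap_sum_gap_sum fam)// /split_set upperI.
Qed.

Lemma split_set0 : split_set set0 = 0.
Proof.
rewrite -(_ : unprimed X set0 = set0); last by rewrite /unprimed image_set0.
by rewrite split_set_unprimed truncated0.
Qed.

Lemma split_setU Z W : vertex_sets Z -> vertex_sets W ->
  split_set (Z `|` W) = split_set Z + split_set W - split_set (Z `&` W).
Proof.
move=> hZ hW; have uZ := upreg hZ; have lZ := low hZ.
have uW := upreg hW; have lW := low hW.
rewrite /split_set lowerU upperU lowerI upperI truncatedU// gap_sumU//.
exact: addrDBACA.
Qed.

(** One formula for two relations: with f = g it is the relation on ranges, and
    for the two pieces of one edge of G, whose ranges are disjoint, it is their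
    orthogonality. *)
Lemma star_split_edge_mul f g : base_edge f = base_edge g ->
  star (split_edge f) ** split_edge g = split_set (rng f `&` rng g).
Proof.
have hr (h : edge GX) := vertex_sets_rng h.
have hd := doubled_vertex_sets finY (vertex_sets_rng (base_edge g)).
move=> fg; rewrite starM star_split_set// fg cmulA -(cmulA (split_set _)).
rewrite (family_rng fam) -split_set_doubled !split_setM//; last first.
  exact: vertex_setsI.
congr split_set; rewrite -setIA; congr (_ `&` _); apply: setIidr.
case: g {fg hd} => [e _ [v ev <-]//|e' _ [w [ew _] <-]//].
Qed.

Lemma split_edge_neq f g : f <> g -> base_edge f = base_edge g ->
  rng f `&` rng g = set0.
Proof.
case: f g => [e|e'] [f|f'] /= fg efg; last 1 first.
- by case: fg; congr inr; exact: val_inj.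
- by case: fg; rewrite efg.
- by rewrite -subset0 => _ [[v _ <-] []].
- by rewrite -subset0 => _ [[v _ <-] []].
Qed.

(** At a regular vertex v the pieces of e add up to s_e s_e^*, and the projection
    of v is p_v without its gap if v is in Y, which makes the summation relation
    true by construction; if v is not in Y then v is in X, and the relation is the
    one imposed in G. *)
Lemma split_family : relative_family (@Reg GX) split_edge split_set.
Proof.
have hr (h : edge GX) := vertex_sets_rng h.
have tq f : split_edge f ** split_set (rng f) = split_edge f.
  by rewrite -cmulA split_setM// setIid.
have tt f : star (split_edge f) ** split_edge f = split_set (rng f).
  by rewrite star_split_edge_mul// setIid.
split.
- by move=> f; rewrite /is_partial_isometry -cmulA tt tq.
- move=> f g fg; rewrite cmulA -(cmulA (split_edge f)).
  suff -> : star (split_edge f) ** split_edge g = 0 by rewrite cmul0r cmul0l.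
  have [fg'|fg'] := pselect (base_edge f = base_edge g).
    by rewrite star_split_edge_mul// split_edge_neq// split_set0.
  rewrite starM cmulA -(cmulA (star (split_set _))) (family_star_mul0 fam fg').
  by rewrite cmul0r cmul0l.
- by move=> Z hZ; split; [exact: star_split_set|rewrite split_setM// setIid].
- exact: split_set0.
- exact: split_setM.
- exact: split_setU.
- exact: tt.
- move=> f; rewrite /proj_le.
  have -> : [set src f] = unprimed X [set src (base_edge f)].
    by rewrite /unprimed image_set1; case: f.
  rewrite split_set_unprimed; apply: (can_inj (@starK _ A)).
  have h1 := vertex_sets1 (src (base_edge f)).
  by rewrite starM star_truncated// starM starK !cmulA truncated_src.
- move=> [v|w] regv; last by have := Reg_inr regv.
  have {}regv := (Reg_inl X v).1 regv; have fin := regv.2.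
  have h1 := vertex_sets1 v.
  rewrite (fsum_out_edges_inl (F' := fun e =>
    s e ** split_set (primed X (rng e `&` Y)) ** star (s e)))//; first last.
  + move=> e re; rewrite re -{1}(set0I Y) split_set_primed set0I gap_sum0.
    by rewrite cmul0r cmul0l.
  + move=> e'; rewrite starM star_split_set// cmulA; congr (_ ** _).
    by rewrite -cmulA split_setM// setIid.
  rewrite (eq_fsbigr (fun e => s e ** star (s e))) => [|e _].
    rewrite -(image_set1 inl) -/(unprimed X [set v]) split_set_unprimed.
    rewrite /truncated.
    have [Yv|nYv] := pselect (Y v).
      rewrite setIidl => [|? ->//].
      by rewrite /gap_sum fsbig_set1 /gap opprB addrC subrK.
    rewrite (_ : _ `&` _ = set0) => [|]; last first.
      by rewrite -subset0 => _ [-> /nYv].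
    rewrite gap_sum0 subr0 (family_sum fam)//.
    by apply: contrapT => nXv; apply: nYv.
  rewrite starM star_split_set// cmulA tq /split_edge -cmulDl.
  rewrite -cmulDr split_set_unprimed split_set_primed subrK.
  by rewrite (family_rng_mul fam).
Qed.

End InverseFamily.

Section InverseFormula.
Variables (G : ultragraph) (X : set (vertex G)).
Hypothesis finY : forall e : edge G, finite_set (rng e `&` RegD X).
Variables (R : realType) (A B : cstarAlgType R).
Variables (s : edge G -> A) (p : set (vertex G) -> A).
Hypothesis fam : relative_family X s p.
Variables (S : edge (primed_ultragraph X) -> B).
Variables (P : set (vertex (primed_ultragraph X)) -> B).

(** The formula for psi prescribes its values on the generators and nothing more:
    every Z is described by its lower and upper parts, and the prescribed value
    does depend on Z alone. *)
Lemma psi_formulaP (psi : B -> A) :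
  psi_formula s p S P psi <->
  (forall f, psi (S f) = split_edge s p f) /\
  (forall Z, vertex_sets Z -> psi (P Z) = split_set s p Z).
Proof.
have edge_inl e : split_edge s p (inl e : edge (primed_ultragraph X)) =
    s e ** (p (rng e) - p (rng e `&` RegD X) + edge_sum s (rng e `&` RegD X)).
  rewrite -(truncatedE finY fam); last exact: vertex_sets_rng.
  by rewrite -split_set_unprimed.
have edge_inr (e' : split_edges X) :
    split_edge s p (inr e' : edge (primed_ultragraph X)) =
    s (val e') ** (p (rng (val e') `&` RegD X) -
                   edge_sum s (rng (val e') `&` RegD X)).
  rewrite (family_set_edge_sum fam).
    by rewrite -(split_set_primed fam).
  by apply: vertex_sets_finite_regular => //; exact: vertex_sets_rng.
split=> [[hP hS hS']|[hS hP]].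
  split=> [[e|e']|Z hZ]; first by rewrite edge_inl.
    by rewrite edge_inr.
  have [fU _] := upper_finite_regular finY hZ.
  have UY : upper Z `&` RegD X = upper Z by rewrite setIidl//; exact: upper_sub.
  have hl := lower_vertex_sets hZ.
  rewrite (hP Z (lower Z) (upper Z))// ?UY ?lower_upperE//.
    by rewrite -(truncatedE finY fam).
  exact: vertex_sets_finite.
split=> [Z C D hZ hC hD ZE|e|e']; rewrite ?hS ?hP//.
rewrite -(truncatedE finY fam)// ZE /split_set.
by rewrite lower_unprimed_primed upper_unprimed_primed.
Qed.

End InverseFormula.

(** * Merging: a family for the relative ultragraph *)

Section DirectFamily.
Variables (G : ultragraph) (X : set (vertex G)).
Hypothesis subX : X `<=` @Reg G.
Hypothesis finY : forall e : edge G, finite_set (rng e `&` RegD X).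
Variables (R : realType) (B : cstarAlgType R).
Variables (S : edge (primed_ultragraph X) -> B).
Variables (P : set (vertex (primed_ultragraph X)) -> B).
Hypothesis fam : relative_family (@Reg (primed_ultragraph X)) S P.

Local Notation Y := (RegD X).
Local Notation GX := (primed_ultragraph X).
Implicit Types (C D : set (vertex G)) (Z W : set (vertex GX)).

(** S_{e'} when e has a copy, and 0 otherwise, so that both cases of the formula
    for phi(s_e) become one sum. *)
Definition twin_edge (e : edge G) : B :=
  if (insub e : option (split_edges X)) is Some e' then S (inr e') else 0.

Definition merged_edge e : B := S (inl e) + twin_edge e.

Definition merged_set C : B := P (doubled X C).

Lemma twin_edge_val (e' : split_edges X) : twin_edge (val e') = S (inr e').
Proof. by rewrite /twin_edge valK. Qed.

Lemma twin_edge0 e : rng e `&` Y = set0 -> twin_edge e = 0.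
Proof.
move=> re; rewrite /twin_edge; case: insubP => // e' /set_mem.
by rewrite /split_edges /= re => -[].
Qed.

Lemma split_edgesP e :
  rng e `&` Y = set0 \/ exists e' : split_edges X, e = val e'.
Proof.
have [/mem_set re|re] := pselect (split_edges X e).
  by right; exists (exist _ e re).
by left; rewrite -subset0 => w rw; apply: re; exists w.
Qed.

Lemma star_inl_twin e f : star (S (inl e)) ** twin_edge f = 0.
Proof.
have [/twin_edge0 ->|[f' ->]] := split_edgesP f; first exact: cmul0r.
by rewrite twin_edge_val (family_star_mul0 fam).
Qed.

Lemma star_twin_inl e f : star (twin_edge e) ** S (inl f) = 0.
Proof.
apply: (can_inj (@starK _ B)).
by rewrite starM starK star_inl_twin star0.
Qed.

Lemma star_twin_twin e f : e <> f -> star (twin_edge e) ** twin_edge f = 0.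
Proof.
have [/twin_edge0 ->|[e' ->]] := split_edgesP e; first by rewrite star0 cmul0l.
have [/twin_edge0 ->|[f' ->]] := split_edgesP f; first by rewrite cmul0r.
move=> ef; rewrite !twin_edge_val (family_star_mul0 fam)// => -[ef'].
by apply: ef; rewrite ef'.
Qed.

Lemma primed0 : primed X set0 = set0.
Proof. by rewrite -subset0 => z []. Qed.

Lemma star_twin e :
  star (twin_edge e) ** twin_edge e = P (primed X (rng e `&` Y)).
Proof.
have [re|[e' ->]] := split_edgesP e.
  by rewrite twin_edge0// re primed0 (family_set0 fam) cmul0r.
by rewrite twin_edge_val (family_rng fam).
Qed.

Lemma twin_primed e : twin_edge e ** P (primed X (rng e `&` Y)) = twin_edge e.
Proof.
have [re|[e' ->]] := split_edgesP e; first by rewrite twin_edge0// cmul0l.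
by rewrite twin_edge_val (family_rng_mul fam (inr e')).
Qed.

Lemma unprimedI_primed C D : unprimed X C `&` primed X D = set0.
Proof. by rewrite -subset0 => z [[v _ <-] []]. Qed.

Lemma unprimed_primed_mul C D : vertex_sets C -> vertex_sets D ->
  P (unprimed X C) ** P (primed X (D `&` Y)) = 0.
Proof.
move=> /(@unprimed_vertex_sets _ X _) hC /(primed_vertex_sets finY) hD.
by rewrite (family_setI fam)// unprimedI_primed (family_set0 fam).
Qed.

Lemma primed_unprimed_mul C D : vertex_sets C -> vertex_sets D ->
  P (primed X (D `&` Y)) ** P (unprimed X C) = 0.
Proof.
move=> /(@unprimed_vertex_sets _ X _) hC /(primed_vertex_sets finY) hD.
by rewrite (family_setI fam)// setIC unprimedI_primed (family_set0 fam).
Qed.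

Lemma merged_setE C : vertex_sets C ->
  merged_set C = P (unprimed X C) + P (primed X (C `&` Y)).
Proof.
move=> hC; rewrite /merged_set doubledE (family_split fam) ?unprimedI_primed//.
- exact: unprimed_vertex_sets.
- exact: primed_vertex_sets.
Qed.

(** The two pieces of an edge end in disjoint sets, so the projections of these
    sets recover the pieces from their sum. *)
Lemma merged_edge_unprimed e :
  merged_edge e ** P (unprimed X (rng e)) = S (inl e).
Proof.
have hr := vertex_sets_rng e.
rewrite cmulDl (family_rng_mul fam (inl e)) -twin_primed -cmulA.
by rewrite primed_unprimed_mul// cmul0r addr0.
Qed.

Lemma merged_edge_primed e :
  merged_edge e ** P (primed X (rng e `&` Y)) = twin_edge e.
Proof.
have hr := vertex_sets_rng e.
rewrite cmulDl twin_primed -(family_rng_mul fam (inl e)) -cmulA.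
by rewrite unprimed_primed_mul// cmul0r add0r.
Qed.

(** The cross terms vanish for the same reason: S_e and S_{e'} have orthogonal
    source projections. *)
Lemma inl_star_twin e : S (inl e) ** star (twin_edge e) = 0.
Proof.
have hr := vertex_sets_rng e.
rewrite -(family_rng_mul fam (inl e)) -twin_primed starM.
rewrite (family_star fam); last exact: primed_vertex_sets.
by rewrite cmulA -(cmulA (S _)) unprimed_primed_mul// cmul0r cmul0l.
Qed.

Lemma merged_edge_star e : merged_edge e ** star (merged_edge e) =
  S (inl e) ** star (S (inl e)) + twin_edge e ** star (twin_edge e).
Proof.
rewrite starD cmulDr !cmulDl inl_star_twin add0r; congr (_ + _).
rewrite -[X in _ + X]starK starM starK inl_star_twin star0 addr0//.
Qed.

Lemma star_merged_edge e :
  star (merged_edge e) ** merged_edge e = merged_set (rng e).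
Proof.
rewrite starD cmulDr !cmulDl star_inl_twin star_twin_inl addr0 add0r.
by rewrite (family_rng fam) star_twin merged_setE//; exact: vertex_sets_rng.
Qed.

(** The summation relation of G_X at v involves both copies of each edge, which is
    what the merged edges contribute. Only the old copy of v appears on the right:
    the difference from the projection of the doubled point is where gaps come
    from. *)
Lemma sum_merged_edge v : Reg v ->
  \sum_(e \in out_edges v) merged_edge e ** star (merged_edge e) = P [set inl v].
Proof.
move=> regv; rewrite (family_sum fam); last exact/Reg_inl.
rewrite (fsum_out_edges_inl (F' := fun e => twin_edge e ** star (twin_edge e))).
- by apply: eq_fsbigr => e _; exact: merged_edge_star.
- by case: regv.
- by move=> e'; rewrite twin_edge_val.
- by move=> e /twin_edge0 ->; rewrite cmul0l.
Qed.

(** For the summation relation at v in X, the point v is not in Y, so doubling it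
    adds nothing. *)
Lemma merged_family : relative_family X merged_edge merged_set.
Proof.
have hd := doubled_vertex_sets finY.
split.
- move=> e; rewrite /is_partial_isometry -cmulA star_merged_edge.
  rewrite merged_setE; last exact: vertex_sets_rng.
  by rewrite cmulDr merged_edge_unprimed merged_edge_primed.
- move=> e f ef; rewrite cmulA -(cmulA (merged_edge e)).
  suff -> : star (merged_edge e) ** merged_edge f = 0 by rewrite cmul0r cmul0l.
  rewrite starD cmulDr !cmulDl star_inl_twin star_twin_inl star_twin_twin//.
  by rewrite (family_star_mul0 fam) ?addr0// => -[].
- by move=> C /hd /(family_proj fam).
- by rewrite /merged_set (_ : doubled X set0 = set0) ?(family_set0 fam).
- by move=> C D hC hD; rewrite /merged_set (family_setI fam)//; exact: hd.
- by move=> C D hC hD; rewrite /merged_set -(family_setU fam)//; exact: hd.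
- exact: star_merged_edge.
- move=> e; have h1 := hd _ (vertex_sets1 (src e)).
  rewrite /proj_le; apply: (can_inj (@starK _ B)).
  rewrite starM starM starK (family_star fam)// cmulA; congr (_ ** _).
  rewrite cmulDr (family_set_mul fam)// mem_set//; congr (_ + _).
  have [/twin_edge0 ->|[e' ee']] := split_edgesP e; first exact: cmul0r.
  rewrite [in twin_edge _]ee' twin_edge_val (family_set_mul fam)// mem_set//.
  by rewrite ee'.
- move=> v Xv; have regv := subX Xv; rewrite sum_merged_edge//.
  congr P; apply/seteqP; split=> [[u|w] //= h|_ ->]//; first by rewrite h.
  by have [_] := RegD_val w; rewrite h.
Qed.

Section DirectMap.
Variables (A : cstarAlgType R) (s : edge G -> A) (p : set (vertex G) -> A).
Variable phi : A -> B.
Hypotheses (hphi : star_hom phi).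
Hypothesis phi_edge : forall e, phi (s e) = merged_edge e.
Hypothesis phi_set : forall C, vertex_sets C -> phi (p C) = merged_set C.

(** The gap at w is the defect of the summation relation at w, and for merged
    generators this is the projection of the sink w'. *)
Lemma phi_gap w : Y w -> phi (gap s p w) = P (primed X [set w]).
Proof.
move=> Yw; have [regw _] := Yw; have fin := regw.2.
have h1 := vertex_sets1 w.
rewrite star_homB// phi_set// star_hom_fsum//.
rewrite (eq_fsbigr (fun e => merged_edge e ** star (merged_edge e))); last first.
  by move=> e _; rewrite star_homM// star_hom_star// phi_edge.
rewrite sum_merged_edge// merged_setE// setIidl => [|_ ->//].
by rewrite /unprimed image_set1 addrAC subrr add0r.
Qed.

Lemma phi_gap_sum D : finite_set D -> D `<=` Y ->
  phi (gap_sum s p D) = P (primed X D).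
Proof.
move: D; apply: finite_set_ind => [_|w D fD Dw IH DY].
  by rewrite gap_sum0 primed0 (family_set0 fam) -(subrr 0) star_homB// subrr.
have DY' : D `<=` Y by move=> v Dv; apply: DY; right.
have Yw : Y w by apply: DY; left.
rewrite /gap_sum fsbigU0//; last by move=> v [/= ->].
rewrite fsbig_set1 star_homD// phi_gap// -/(gap_sum s p D) IH//.
have primedU E F : primed X (E `|` F) = primed X E `|` primed X F.
  by rewrite -image_setU; congr (_ @` _).
rewrite primedU (family_split fam)//.
- rewrite -(setIidl (B := Y) (A := [set w])) => [|_ ->//].
  by apply: primed_vertex_sets => //; exact: vertex_sets1.
- rewrite -(setIidl DY'); apply: primed_vertex_sets => //.
  exact: vertex_sets_finite.
rewrite -subset0 => _ [[u /= uw <-] [v Dv vu]].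
by apply: Dw; rewrite -uw -(inr_inj vu).
Qed.

Lemma phi_split_set Z : vertex_sets Z -> phi (split_set s p Z) = P Z.
Proof.
move=> hZ; have hl := lower_vertex_sets hZ.
have [fU _] := upper_finite_regular finY hZ.
have UY := @upper_sub _ _ Z.
have [fL _] := vertex_sets_finite_regular finY hl.
have LY : lower Z `&` Y `<=` Y by move=> v [].
rewrite /split_set star_homD// star_homB// phi_set// !phi_gap_sum//.
rewrite merged_setE// addrK -[in RHS](lower_upperE Z) (family_split fam)//.
- exact: unprimed_vertex_sets.
- rewrite -(setIidl UY); apply: primed_vertex_sets => //.
  exact: vertex_sets_finite.
- exact: unprimedI_primed.
Qed.

Lemma phi_split_edge f : phi (split_edge s p f) = S f.
Proof.
rewrite star_homM// phi_edge phi_split_set; last exact: vertex_sets_rng.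
case: f => [e|e'] /=; first exact: merged_edge_unprimed.
by rewrite merged_edge_primed twin_edge_val.
Qed.

End DirectMap.

Section InverseMap.
Variables (A : cstarAlgType R) (s : edge G -> A) (p : set (vertex G) -> A).
Hypothesis famA : relative_family X s p.
Variable psi : B -> A.
Hypotheses (hpsi : star_hom psi).
Hypothesis psi_edge : forall f, psi (S f) = split_edge s p f.
Hypothesis psi_set : forall Z, vertex_sets Z -> psi (P Z) = split_set s p Z.

Lemma psi_merged_set C : vertex_sets C -> psi (merged_set C) = p C.
Proof.
move=> hC; rewrite psi_set ?split_set_doubled//.
exact: doubled_vertex_sets.
Qed.

Lemma psi_merged_edge e : psi (merged_edge e) = s e.
Proof.
have twinE : psi (twin_edge e) = s e ** split_set s p (primed X (rng e `&` Y)).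
  have [re|[e' ->]] := split_edgesP e; last by rewrite twin_edge_val psi_edge.
  rewrite re primed0 (split_set0 famA) cmul0r twin_edge0//.
  by rewrite -(subrr 0) star_homB// subrr.
rewrite star_homD// psi_edge twinE -cmulDr split_set_unprimed.
by rewrite (split_set_primed famA) subrK (family_rng_mul famA).
Qed.

End InverseMap.

End DirectFamily.

(** * The isomorphism *)

Section UniversalProperty.
Variables (G : ultragraph) (X : set (vertex G)) (R : realType).
Variables (A : cstarAlgType R) (s : edge G -> A) (p : set (vertex G) -> A).
Hypothesis univ : is_relative_algebra X s p.

Lemma relative_algebra_hom_eq (D : cstarAlgType R) (f g : A -> D)
    (t : edge G -> D) (q : set (vertex G) -> D) :
  relative_family X t q -> star_hom f -> star_hom g ->
  (forall e, f (s e) = t e) -> (forall e, g (s e) = t e) ->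
  (forall C, vertex_sets C -> f (p C) = q C) ->
  (forall C, vertex_sets C -> g (p C) = q C) -> f = g.
Proof.
move=> famt hf hg fs gs fp gp; have [h [_ huniq]] := univ.2 D t q famt.
by rewrite -(huniq f)// -(huniq g).
Qed.

Lemma relative_algebra_hom_id (f : A -> A) : star_hom f ->
  (forall e, f (s e) = s e) -> (forall C, vertex_sets C -> f (p C) = p C) ->
  f =1 id.
Proof.
move=> hf fs fp a; rewrite (@relative_algebra_hom_eq A f id s p)//.
exact: univ.1.
Qed.

End UniversalProperty.

Theorem theorem2p14 (R : realType) (G : ultragraph) (X : set (vertex G))
    (hX : X `<=` @Reg G)
    (hfin : forall e : edge G, finite_set (rng e `&` RegD X))
    (A : cstarAlgType R) (s : edge G -> A) (p : set (vertex G) -> A)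
    (hA : is_relative_algebra X s p)
    (B : cstarAlgType R) (S : edge (primed_ultragraph X) -> B)
    (P : set (vertex (primed_ultragraph X)) -> B)
    (hB : is_ultragraph_algebra S P) :
  exists (phi : A -> B) (psi : B -> A),
    [/\ star_hom phi /\ phi_formula s p S P phi,
        star_hom psi /\ psi_formula s p S P psi,
        cancel phi psi /\ cancel psi phi &
        forall psi' : B -> A,
          star_hom psi' -> psi_formula s p S P psi' -> psi' = psi].
Proof.
have [[famA uA] [famB uB]] := (hA, hB).
have fam_merged := merged_family hX hfin famB.
have fam_split := split_family hfin famA.
have [phi [[hphi phis phip] _]] := uA _ _ _ fam_merged.
have [psi [[hpsi psis psip] _]] := uB _ _ _ fam_split.
have psiE := psi_formulaP hfin famA S P.
exists phi, psi; split.
- split=> //; split=> [C hC|e re|e'].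
  + by rewrite phip// (merged_setE hfin famB).
  + by rewrite phis /merged_edge twin_edge0// addr0.
  + by rewrite phis /merged_edge twin_edge_val.
- by split=> //; apply/psiE.
- split=> [a|b].
  + apply: (relative_algebra_hom_id hA (f := psi \o phi)) => [|e|C hC] /=.
    * exact: star_hom_comp.
    * by rewrite phis (psi_merged_edge famA hpsi psis).
    * by rewrite phip// (psi_merged_set hfin psip).
  + apply: (relative_algebra_hom_id hB (f := phi \o psi)) => [|f|Z hZ] /=.
    * exact: star_hom_comp.
    * by rewrite psis (phi_split_edge hfin famB hphi phis phip).
    * by rewrite psip// (phi_split_set hfin famB hphi phis phip).
- move=> psi' hpsi' /psiE [psis' psip'].
  exact: (relative_algebra_hom_eq hB fam_split).
Qed.
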